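(* Let $\mathcal K\subset\mathbb{R}^m$ be the $m$-dimensional second-order cone and $\Omega=\{(x,y):x\in\mathcal K,\ y\in\mathcal K,\ x^Ty=0\}$. Then for any $(x,y)\in\Omega$, $T^i_\Omega(x,y)=T_\Omega(x,y)$, and this set consists of all $(d,w)\in\mathbb{R}^m\times\mathbb{R}^m$ such that: - $d=0$, $w\in\mathbb{R}^m$, if $x=0$, $y\in\mathrm{int}\,\mathcal K$; - $d\in\mathbb{R}^m$, $w=0$, if $x\in\mathrm{int}\,\mathcal K$, $y=0$; - $x_1\hat w-y_1d\in\mathbb{R}x$, $d\perp y$, $w\perp x$, if $x,y\in\mathrm{bd}\,\mathcal K\setminus\{0\}$; - either $d=0$ and $w\in T_{\mathcal K}(y)$, or $d\in\mathbb{R}_+\hat y$ and $w\perp\hat y$, if $x=0$, $y\in\mathrm{bd}\,\mathcal K\setminus\{0\}$; - either $d\in T_{\mathcal K}(x)$ and $w=0$, or $d\perp\hat x$ and $w\in\mathbb{R}_+\hat x$, if $x\in\mathrm{bd}\,\mathcal K\setminus\{0\}$, $y=0$; - $d\in\mathcal K$, $w\in\mathcal K$, $d\perp w$, if $x=0$, $y=0$.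
   Context: $\mathcal K=\{(x_1,x_2)\in\mathbb{R}\times\mathbb{R}^{m-1}:x_1\ge\|x_2\|\}$ ($\mathcal K=\mathbb{R}_+$ if $m=1$). For $z=(z_1,z_2)\in\mathbb{R}\times\mathbb{R}^{m-1}$, $\hat z=(z_1,-z_2)$. $\mathbb{R}x=\{tx:t\in\mathbb{R}\}$, $\mathbb{R}_+x=\{tx:t\ge0\}$; int and bd denote interior and boundary. For $C\subseteq\mathbb{R}^n$, $z\in C$: $T_C(z)=\{u:\exists t_k\downarrow 0,\ u_k\to u \text{ with } z+t_ku_k\in C\ \forall k\}$ and $T^i_C(z)=\{u:\forall t_k\downarrow 0,\ \exists u_k\to u \text{ with } z+t_ku_k\in C\ \forall k\}$. *)

(* Defs.v *)
From HB Require Import structures.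
From mathcomp Require Import all_boot all_order all_algebra.
From mathcomp Require Import all_classical all_reals all_analysis.

Set Implicit Arguments.
Unset Strict Implicit.
Unset Printing Implicit Defensive.

Import Order.TTheory GRing.Theory Num.Theory.
Import numFieldNormedType.Exports.

Local Open Scope classical_set_scope.
Local Open Scope ring_scope.

(* R^m is 'cV[R]_m with m = 1 + n, split as R x R^n by usubmx / dsubmx, so that
   every m >= 1 is covered. The library's norm `|_| on matrices is the sup
   norm: it is only used for the topology (which is the Euclidean one), and the
   Euclidean inner product and norm are defined separately. *)

Definition dotv (R : realType) (m : nat) (u v : 'cV[R]_m) : R :=
  (u^T *m v) 0 0.

Definition enorm (R : realType) (m : nat) (u : 'cV[R]_m) : R :=
  Num.sqrt (dotv u u).

Definition hd (R : realType) (n : nat) (z : 'cV[R]_(1 + n)) : R :=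
  usubmx z 0 0.

Definition tl (R : realType) (n : nat) (z : 'cV[R]_(1 + n)) : 'cV[R]_n :=
  dsubmx z.

Definition hat (R : realType) (n : nat) (z : 'cV[R]_(1 + n)) :
    'cV[R]_(1 + n) :=
  col_mx (usubmx z) (- dsubmx z).

(* For n = 0 the tail is the empty vector, of norm 0, so the cone is R_+. *)
Definition soc (R : realType) (n : nat) : set 'cV[R]_(1 + n) :=
  [set x | enorm (tl x) <= hd x].

Definition soc_compl (R : realType) (n : nat) :
    set ('cV[R]_(1 + n) * 'cV[R]_(1 + n)) :=
  [set z | [/\ soc z.1, soc z.2 & dotv z.1 z.2 = 0]].

Definition bd (T : topologicalType) (A : set T) : set T :=
  closure A `\` interior A.

Definition line (R : realType) (V : lmodType R) (x : V) : set V :=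
  [set t *: x | t in [set: R]].

Definition ray (R : realType) (V : lmodType R) (x : V) : set V :=
  [set t *: x | t in [set t : R | 0 <= t]].

(* t_k decreases to 0 in the sense of variational analysis: positive terms and
   limit 0, without monotonicity. *)
Definition to0plus (R : realType) (t : nat -> R) : Prop :=
  (forall k, 0 < t k) /\ (t @ \oo --> (0 : R)).

Definition tangent (R : realType) (V : normedModType R) (C : set V) (z : V) :
    set V :=
  [set u | exists t : nat -> R, exists v : nat -> V,
     [/\ to0plus t, v @ \oo --> u & forall k, C (z + t k *: v k)]].

Definition inner_tangent (R : realType) (V : normedModType R) (C : set V)
    (z : V) : set V :=
  [set u | forall t : nat -> R, to0plus t ->
     exists v : nat -> V,
       v @ \oo --> u /\ forall k, C (z + t k *: v k)].

(* Main.v *)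
Require Import Defs.
From HB Require Import structures.
From mathcomp Require Import all_boot all_order all_algebra.
From mathcomp Require Import all_classical all_reals all_analysis.
From mathcomp Require Import ring lra.

Import Order.TTheory GRing.Theory Num.Theory.
Import numFieldNormedType.Exports.

Local Open Scope classical_set_scope.
Local Open Scope ring_scope.

(** Write [Q z = dotv z (hat z)], so that [z] is in the cone iff [hd z >= 0] and
    [Q z >= 0], and a point of the cone is on its boundary iff [Q z = 0].
    Cauchy-Schwarz turns complementarity of [x] and [y] into the polynomial
    identity [hd x *: hat y = hd y *: x]. Substituting [x + t d], [y + t w] in it
    and in its consequence [hd y * Q x = 0], dividing by [t] and letting [t] tend
    to [0] gives the inclusion of the tangent cone in the announced set.
    Conversely, a direction [w] at a boundary point [y <> 0] of the cone can be
    corrected along the axis so that, at the moved point [z], the head exceeds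
    the norm of the tail by exactly [t * dotv w (hat y) / hd y]; when this
    vanishes [z] is on the boundary, and the pairs [(c *: hat z, z)] with
    [c >= 0] are complementary. The correction is available along an arbitrary
    sequence of steps, hence the announced set is made of inner tangents. *)

(** * Euclidean inner product and norm *)

Section InnerProduct.
Context {R : realType} {m : nat}.
Implicit Types (a : R) (u v w : 'cV[R]_m).

Lemma dotvE u v : dotv u v = \sum_i u i 0 * v i 0.
Proof. by rewrite /dotv mxE; apply: eq_bigr => i _; rewrite mxE. Qed.

Lemma dotvC u v : dotv u v = dotv v u.
Proof. by rewrite !dotvE; apply: eq_bigr => i _; rewrite mulrC. Qed.

Lemma dotvDl u v w : dotv (u + v) w = dotv u w + dotv v w.
Proof. by rewrite /dotv linearD mulmxDl mxE. Qed.

Lemma dotvZl a u v : dotv (a *: u) v = a * dotv u v.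
Proof. by rewrite /dotv linearZ -scalemxAl mxE. Qed.

Lemma dotvDr u v w : dotv u (v + w) = dotv u v + dotv u w.
Proof. by rewrite dotvC dotvDl !(dotvC u). Qed.

Lemma dotvZr a u v : dotv u (a *: v) = a * dotv u v.
Proof. by rewrite dotvC dotvZl dotvC. Qed.

Lemma dotvNl u v : dotv (- u) v = - dotv u v.
Proof. by rewrite -scaleN1r dotvZl mulN1r. Qed.

Lemma dotvNr u v : dotv u (- v) = - dotv u v.
Proof. by rewrite dotvC dotvNl dotvC. Qed.

Lemma dotv0r u : dotv u 0 = 0.
Proof. by rewrite -(scale0r 0) dotvZr mul0r. Qed.

Lemma dotv0l u : dotv 0 u = 0.
Proof. by rewrite dotvC dotv0r. Qed.

Lemma dotv_ge0 u : 0 <= dotv u u.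
Proof. by rewrite dotvE; apply: sumr_ge0 => i _; rewrite -expr2 sqr_ge0. Qed.

Lemma dotv_le0 u : dotv u u <= 0 -> u = 0.
Proof.
move=> u_le0; have /eqP : dotv u u = 0 by apply/eqP; rewrite eq_le u_le0 dotv_ge0.
rewrite dotvE psumr_eq0 => [/allP u0|i _]; last by rewrite -expr2 sqr_ge0.
apply/matrixP => i j; rewrite ord1 mxE; apply/eqP.
by have := u0 i (mem_index_enum _); rewrite -expr2 sqrf_eq0.
Qed.

Lemma enorm_ge0 u : 0 <= enorm u.
Proof. exact: sqrtr_ge0. Qed.

Lemma enorm_sqr u : enorm u ^+ 2 = dotv u u.
Proof. by rewrite sqr_sqrtr ?dotv_ge0. Qed.

End InnerProduct.

(** * The cone, the reflection [hat] and complementary pairs *)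

Section SecondOrderCone.
Context {R : realType} {n : nat}.
Implicit Types (a : R) (x y z d w : 'cV[R]_(1 + n)).

Definition e1 : 'cV[R]_(1 + n) := col_mx 1%:M 0.

Lemma hdE z : hd z = z (lshift n 0) 0.
Proof. by rewrite /hd mxE. Qed.

Lemma hdD x y : hd (x + y) = hd x + hd y.
Proof. by rewrite !hdE mxE. Qed.

Lemma hdZ a x : hd (a *: x) = a * hd x.
Proof. by rewrite !hdE mxE. Qed.

Lemma hdN x : hd (- x) = - hd x.
Proof. by rewrite !hdE mxE. Qed.

Lemma hd0 : hd (0 : 'cV[R]_(1 + n)) = 0.
Proof. by rewrite hdE mxE. Qed.

Lemma hd_e1 : hd e1 = 1.
Proof. by rewrite /hd col_mxKu mxE. Qed.

Lemma hatE z : hat z = (2 * hd z) *: e1 - z.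
Proof.
rewrite -{3}[z]vsubmxK /hat /e1 scale_col_mx opp_col_mx add_col_mx.
rewrite scaler0 sub0r; congr col_mx.
by apply/matrixP => i j; rewrite !ord1 /hd !mxE eqxx mulr1; ring.
Qed.

Lemma hd_hat z : hd (hat z) = hd z.
Proof. by rewrite hatE hdD hdN hdZ hd_e1; ring. Qed.

Lemma hatD x y : hat (x + y) = hat x + hat y.
Proof. by rewrite !hatE hdD mulrDr scalerDl opprD addrACA. Qed.

Lemma hatZ a x : hat (a *: x) = a *: hat x.
Proof. by rewrite !hatE hdZ scalerBr scalerA mulrCA. Qed.

Lemma hatK z : hat (hat z) = z.
Proof. by rewrite {1}hatE hd_hat hatE opprB addrC subrK. Qed.

Lemma dotv_e1 z : dotv z e1 = hd z.
Proof.
by rewrite -{1}[z]vsubmxK /dotv tr_col_mx mul_row_col mulmx0 addr0 mulmx1 mxE.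
Qed.

Lemma dotv_hat x y : dotv x (hat y) = 2 * hd x * hd y - dotv x y.
Proof. by rewrite hatE dotvDr dotvZr dotvNr dotv_e1; ring. Qed.

Lemma dotv_hatl x y : dotv (hat x) y = 2 * hd x * hd y - dotv x y.
Proof. by rewrite dotvC dotv_hat dotvC; ring. Qed.

Lemma dotv_tl z : dotv (tl z) (tl z) = hd z ^+ 2 - dotv z (hat z).
Proof.
have -> : dotv z (hat z) = hd z ^+ 2 - dotv (tl z) (tl z); last by ring.
rewrite /dotv /hat -{1}[z]vsubmxK tr_col_mx mul_row_col mulmxN mxE [in RHS]/hd.
by rewrite [in LHS]mxE big_ord1 !mxE.
Qed.

Lemma dotv_hatxx z : dotv z (hat z) = hd z ^+ 2 - enorm (tl z) ^+ 2.
Proof. by rewrite enorm_sqr dotv_tl; ring. Qed.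

(** With a nonnegative head, both sides of the cone inequality can be squared, and the difference of
    the squares is [dotv z (hat z)]. This polynomial form is what passes to the limit later. *)
Lemma socP z : soc z <-> 0 <= hd z /\ 0 <= dotv z (hat z).
Proof.
have e0 := enorm_ge0 (tl z).
rewrite dotv_hatxx subr_ge0 /soc /=; split=> [le_e|[h0]].
  by have h0 := le_trans e0 le_e; split=> //; rewrite lerXn2r// nnegrE.
by rewrite ler_pXn2r ?nnegrE.
Qed.

Lemma hd_eq0 z : soc z -> hd z = 0 -> z = 0.
Proof.
move=> /socP[_]; rewrite dotv_hat => z0 h0; apply: dotv_le0.
by move: z0; rewrite h0 mulr0 sub0r oppr_ge0.
Qed.

Lemma socZ a z : 0 <= a -> soc z -> soc (a *: z).
Proof.
move=> a0 /socP[h0 z0]; apply/socP.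
by rewrite hdZ hatZ dotvZl dotvZr !mulr_ge0.
Qed.

Lemma soc_hat z : soc z -> soc (hat z).
Proof. by move=> /socP[h0 z0]; apply/socP; rewrite hd_hat hatK dotvC. Qed.

(* For [x, y] in the cone with [dotv x y = 0], the squared norm of
   [hd x *: hat y - hd y *: x] is at most [4 (hd x hd y)^2 - 4 (hd x hd y)^2]. *)
Lemma soc_compl_hat x y : soc_compl (x, y) -> hd x *: hat y = hd y *: x.
Proof.
case=> /= /socP[hx]; rewrite dotv_hat => qx /socP[hy]; rewrite dotv_hat => qy xy.
apply/eqP; rewrite -subr_eq0; apply/eqP/dotv_le0.
rewrite dotvDl !dotvDr !dotvNr !dotvNl !dotvZl !dotvZr !dotv_hat.
rewrite (dotvC (hat y) x) !dotv_hat dotv_hatl hd_hat xy.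
suff : hd x ^+ 2 * dotv y y + hd y ^+ 2 * dotv x x <= 4 * hd x ^+ 2 * hd y ^+ 2.
  by move=> le4; rewrite -subr_ge0; move: le4; rewrite -subr_ge0; congr (0 <= _); ring.
have lex : dotv x x <= 2 * hd x ^+ 2 by lra.
have ley : dotv y y <= 2 * hd y ^+ 2 by lra.
have := ler_wpM2l (sqr_ge0 (hd x)) ley; have := ler_wpM2l (sqr_ge0 (hd y)) lex.
lra.
Qed.

End SecondOrderCone.

(** * Passing to the limit in heads, inner products and reflections *)

Section Limits.
Context {R : realType} {n : nat}.
Implicit Types (a : R) (x y z d w : 'cV[R]_(1 + n)).

Lemma cvg_cst_eq {V : normedModType R} (f : nat -> V) (l c : V) :
  f @ \oo --> l -> (forall k, f k = c) -> l = c.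
Proof.
move=> fl fc; apply: (cvg_unique (@norm_hausdorff _ V) fl).
by have -> : f = (fun=> c) by [apply/funext]; exact: cvg_cst.
Qed.

Lemma cvg_ge0 (f : nat -> R) a :
  f @ \oo --> a -> (forall k, 0 <= f k) -> 0 <= a.
Proof.
move=> fa f0; rewrite -(cvg_lim (@Rhausdorff R) fa).
by apply: limr_ge; [exact: (cvgP a)|exact: nearW].
Qed.

Lemma to0plus_harmonic : to0plus (@harmonic R).
Proof. by split; [move=> k; rewrite /= invr_gt0|exact: cvg_harmonic]. Qed.

Context {T : Type} {F : set_system T} {FF : Filter F}.

Lemma cvg_hd (f : T -> 'cV[R]_(1 + n)) x :
  f @ F --> x -> hd (f k) @[k --> F] --> hd x.
Proof.
move=> fx; rewrite hdE; under eq_fun do rewrite hdE.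
exact: (cvg_comp f _ fx (@coord_continuous R _ _ _ _ x)).
Qed.

Lemma cvg_dotv m (f g : T -> 'cV[R]_m) (u v : 'cV[R]_m) :
  f @ F --> u -> g @ F --> v -> dotv (f k) (g k) @[k --> F] --> dotv u v.
Proof.
move=> fu gv; rewrite dotvE; under eq_fun do rewrite dotvE.
apply: cvg_big => [|i _]; first exact: add_continuous.
apply: cvgM.
- exact: (cvg_comp f _ fu (@coord_continuous R _ _ _ _ u)).
- exact: (cvg_comp g _ gv (@coord_continuous R _ _ _ _ v)).
Qed.

Lemma cvg_hat (f : T -> 'cV[R]_(1 + n)) x :
  f @ F --> x -> hat (f k) @[k --> F] --> hat x.
Proof.
move=> fx; rewrite hatE; under eq_fun do rewrite hatE.
apply: cvgB => //; apply: cvgZ; last exact: cvg_cst.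
by apply: cvgM; [exact: cvg_cst|exact: cvg_hd].
Qed.

Lemma cvg_step {V : normedModType R} (z u : V) (t : T -> R) (v : T -> V) :
  t @ F --> (0 : R) -> v @ F --> u -> z + t k *: v k @[k --> F] --> z.
Proof.
move=> t0 vu; rewrite -[X in _ --> X]addr0 -[X in _ --> _ + X](scale0r u).
by apply: cvgD; [exact: cvg_cst|exact: cvgZ].
Qed.

End Limits.

(** * Interior and boundary of the cone *)

Section Interior.
Context {R : realType} {n : nat}.
Implicit Types (a : R) (x y z d w : 'cV[R]_(1 + n)).

Lemma interior_socP z : interior (@soc R n) z <-> 0 < hd z /\ 0 < dotv z (hat z).
Proof.
split=> [zi|[h0 q0]].
- have [t0 tc] := @to0plus_harmonic R.
  (* Some [z - t e1] with [t > 0] is still in the cone. There the head is [hd z - t] and the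
     quadratic form is [Q z - t (2 hd z - t)]; both being nonnegative forces [hd z] and [Q z] to be
     positive. *)
  have := cvg_step z _ _ _ tc (cvg_cst (- e1)) _ zi.
  case=> N _ /(_ N (leqnn N)) /=; set t := N.+1%:R^-1.
  have {}t0 : 0 < t by exact: t0.
  move=> /socP; rewrite !(hdD, hdZ, hdN, hd_e1) dotv_hat.
  rewrite !(hdD, hdZ, hdN, hd_e1) !(dotvDl, dotvDr, dotvZl, dotvZr, dotvNl, dotvNr).
  rewrite (dotvC e1 z) !dotv_e1 hd_e1 dotv_hat => -[h0].
  have : 0 < t * (2 * hd z - t) by apply: mulr_gt0 => //; lra.
  by split; lra.
- have zz : id @ nbhs z --> z by exact: cvg_id.
  have hc : hd u @[u --> z] --> hd z by exact: cvg_hd.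
  have qc : dotv u (hat u) @[u --> z] --> dotv z (hat z).
    by exact: (cvg_dotv _ _ _ _ _ zz (cvg_hat _ _ zz)).
  have h : \forall u \near z, 0 < hd u by apply: (cvgr_gt _ hc).
  have q : \forall u \near z, 0 < dotv u (hat u) by apply: (cvgr_gt _ qc).
  by apply: filterS2 h q => u hu qu; apply/socP; split; exact: ltW.
Qed.

Lemma bd_socP z : soc z -> (bd (@soc R n) `\ 0) z <-> 0 < hd z /\ dotv z (hat z) = 0.
Proof.
move=> zK; have [h0 q0] := (socP z).1 zK; split=> [[[_ zi] /= z0]|[hgt q]].
- have hgt : 0 < hd z.
    by rewrite lt_neqAle h0 andbT eq_sym; apply/eqP => /(hd_eq0 _ zK).
  split=> //; apply/eqP; rewrite eq_le q0 andbT leNgt; apply/negP => qgt.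
  by apply: zi; apply/interior_socP.
- split; first split; first exact: subset_closure.
  + by move=> /interior_socP[_]; rewrite q ltxx.
  + by move=> /= z0; move: hgt; rewrite z0 hd0 ltxx.
Qed.

End Interior.

(** * Tangent cones of the complementarity set and their symmetry *)

Section TangentCones.
Context {R : realType}.

Lemma inner_tangent_sub {V : normedModType R} (C : set V) z :
  inner_tangent C z `<=` tangent C z.
Proof.
move=> u uC; have t0 := @to0plus_harmonic R.
by have [v [vu vC]] := uC _ t0; exists (@harmonic R), v.
Qed.

Lemma inner_tangent_near {V : normedModType R} (C : set V) z u :
  C z ->
  (forall t, to0plus t -> exists2 v : nat -> V, v @ \oo --> u &
     \forall k \near \oo, C (z + t k *: v k)) ->
  inner_tangent C z u.
Proof.
move=> zC h t t0; have [v vu vC] := h t t0.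
(* The value 0 at the finitely many bad indices gives the point [z], which lies in [C], and leaves
   the limit unchanged. *)
exists (fun k => if pselect (C (z + t k *: v k)) then v k else 0); split.
  apply: cvg_trans vu; apply: near_eq_cvg; apply: filterS vC => k kC.
  by case: (pselect (C (z + t k *: v k))).
by move=> k; case: (pselect (C (z + t k *: v k))) => [|nC] //=; rewrite scaler0 addr0.
Qed.

Context {n : nat}.
Local Notation Om := (@soc_compl R n).
Implicit Types (a : R) (x y z d w : 'cV[R]_(1 + n)).

Lemma soc_complC x y : Om (x, y) -> Om (y, x).
Proof. by case=> /= xK yK xy; split=> //=; rewrite dotvC. Qed.

Lemma tangent_complP x y d w : tangent Om (x, y) (d, w) <->
  exists t : nat -> R, exists dk wk : nat -> 'cV[R]_(1 + n),
    [/\ to0plus t, dk @ \oo --> d, wk @ \oo --> w &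
      forall k, Om (x + t k *: dk k, y + t k *: wk k)].
Proof.
split=> [[t [v [t0 vu vC]]]|[t [dk [wk [t0 dd ww C]]]]].
- exists t, (fst \o v), (snd \o v); split=> //.
  + exact: (cvg_comp v fst vu (@cvg_fst _ _ (nbhs d) (nbhs w) _)).
  + exact: (cvg_comp v snd vu (@cvg_snd _ _ (nbhs d) (nbhs w) _)).
- exists t, (fun k => (dk k, wk k)); split=> //.
  exact: (@cvg_pair _ _ _ _ (nbhs d) (nbhs w) _ _ _ _ _ dd ww).
Qed.

Lemma inner_tangent_compl_near x y d w : Om (x, y) ->
  (forall t, to0plus t -> exists dk wk : nat -> 'cV[R]_(1 + n),
    [/\ dk @ \oo --> d, wk @ \oo --> w &
      \forall k \near \oo, Om (x + t k *: dk k, y + t k *: wk k)]) ->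
  inner_tangent Om (x, y) (d, w).
Proof.
move=> xyO h; apply: inner_tangent_near => // t /h[dk [wk [dd ww C]]].
exists (fun k => (dk k, wk k)) => //.
exact: (@cvg_pair _ _ _ _ (nbhs d) (nbhs w) _ _ _ _ _ dd ww).
Qed.

(** Exchanging the two factors reduces the cases with [y = 0] to those with [x = 0]. *)
Lemma tangent_complC x y d w :
  tangent Om (x, y) (d, w) -> tangent Om (y, x) (w, d).
Proof.
move=> /tangent_complP[t [dk [wk [t0 dd ww C]]]]; apply/tangent_complP.
by exists t, wk, dk; split=> // k; exact: soc_complC.
Qed.

Lemma inner_tangent_complC x y d w :
  inner_tangent Om (x, y) (d, w) -> inner_tangent Om (y, x) (w, d).
Proof.
move=> h t /h[v [vu vC]]; exists (fun k => ((v k).2, (v k).1)); split.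
  apply: (@cvg_pair _ _ _ _ (nbhs w) (nbhs d) _ _ _ (fun k => (v k).2)).
  + exact: (cvg_comp v snd vu (@cvg_snd _ _ (nbhs d) (nbhs w) _)).
  + exact: (cvg_comp v fst vu (@cvg_fst _ _ (nbhs d) (nbhs w) _)).
by move=> k; exact: soc_complC (vC k).
Qed.

End TangentCones.

(** * Complementary pairs and motion near the boundary of the cone *)

Section TangentFormulas.
Context {R : realType} {n : nat}.
Local Notation K := (@soc R n).
Local Notation Om := (@soc_compl R n).
Implicit Types (a c s : R) (x y z d w : 'cV[R]_(1 + n)).

Lemma dotv_hatC x y : dotv x (hat y) = dotv y (hat x).
Proof. by rewrite !dotv_hat dotvC; ring. Qed.

Lemma dotv_hat_hat x y : dotv (hat x) (hat y) = dotv x y.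
Proof. by rewrite dotv_hat dotv_hatl hd_hat; ring. Qed.

Lemma dotv_hat_step a y w :
  dotv (y + a *: w) (hat (y + a *: w)) =
  dotv y (hat y) + a * (2 * dotv w (hat y) + a * dotv w (hat w)).
Proof.
by rewrite hatD hatZ !(dotvDl, dotvDr, dotvZl, dotvZr) (dotv_hatC y w); ring.
Qed.

(** Pairing [hd x *: hat y = hd y *: x] with [y] gives [hd x * Q y = 0], where [Q y > 0]. *)
Lemma soc_compl_interior x y : Om (x, y) -> interior K y -> x = 0.
Proof.
move=> xyO /interior_socP[y0 q0]; case: (xyO) => /= xK yK xy.
apply: (hd_eq0 _ xK).
have /(congr1 (dotv y)) := soc_compl_hat _ _ xyO.
rewrite !dotvZr (dotvC y x) xy mulr0 => /eqP; rewrite mulf_eq0 (gt_eqF q0) orbF.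
by move/eqP.
Qed.

Lemma soc_cases z : K z -> [\/ z = 0, interior K z | (bd K `\ 0) z].
Proof.
move=> zK; have [->|z0] := eqVneq z 0; first by constructor 1.
have [zi|zi] := pselect (interior K z); first by constructor 2.
by constructor 3; split; [split=> //; exact: subset_closure|exact/eqP].
Qed.

Lemma soc_compl_ray x y : Om (x, y) -> 0 < hd y -> ray (hat y) x.
Proof.
move=> xyO y0; have e := soc_compl_hat _ _ xyO; case: xyO => /= /socP[x0 _] _ _.
exists (hd x / hd y); first by rewrite /= divr_ge0// ltW.
by rewrite mulrC -scalerA e scalerA mulVf ?scale1r// gt_eqF.
Qed.

Lemma boundary_step y w (t : nat -> R) :
  0 < hd y -> dotv y (hat y) = 0 -> to0plus t ->
  exists2 v : nat -> 'cV[R]_(1 + n), v @ \oo --> w &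
    \forall k \near \oo, hd (y + t k *: v k) =
      enorm (tl (y + t k *: v k)) + t k * (dotv w (hat y) / hd y).
Proof.
move=> y0 q0 [tgt t0]; set a := dotv w (hat y).
pose p k := y + t k *: w; pose S k := enorm (tl (p k)).
(* The excess [hd - S] at [p k] is [(hd ^+ 2 - S ^+ 2) / (S + hd)], that is, [t k] times the
   subtracted fraction. The correction cancels it and puts [a / hd y] in its place; it tends to 0
   because [S + hd] tends to [2 hd y]. *)
pose e k := a / hd y - (2 * a + t k * dotv w (hat w)) / (S k + hd (p k)).
have pc : p @ \oo --> y by apply: cvg_step => //; exact: cvg_cst.
have p1 : hd (p k) @[k --> \oo] --> hd y by exact: cvg_hd.
have Sc : S @ \oo --> hd y.
  have -> : hd y = enorm (tl y).
    by rewrite /enorm dotv_tl q0 subr0 sqrtr_sqr gtr0_norm.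
  rewrite /S /enorm; under eq_fun do rewrite dotv_tl expr2; rewrite dotv_tl expr2.
  have Qc : hd (p k) * hd (p k) - dotv (p k) (hat (p k)) @[k --> \oo] -->
      hd y * hd y - dotv y (hat y).
    by apply: cvgB; [exact: (cvgM p1 p1)|apply: cvg_dotv => //; exact: cvg_hat].
  exact: (cvg_comp _ _ Qc (@sqrt_continuous R _)).
have Spc : S k + hd (p k) @[k --> \oo] --> hd y + hd y by exact: cvgD.
have ec : e @ \oo --> (0 : R).
  have -> : 0 = a / hd y - (2 * a + 0 * dotv w (hat w)) / (hd y + hd y).
    by field; rewrite !gt_eqF ?addr_gt0.
  rewrite /e; apply: cvgB; first exact: cvg_cst.
  apply: cvgM; last by apply: cvgV => //; rewrite gt_eqF// addr_gt0.
  by apply: cvgD; [exact: cvg_cst|apply: cvgM => //; exact: cvg_cst].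
exists (fun k => w + e k *: e1).
  have : w + e k *: e1 @[k --> \oo] --> w + 0 *: e1.
    by apply: cvgD; [exact: cvg_cst|apply: cvgZ => //; exact: cvg_cst].
  by rewrite scale0r addr0.
have Sp_gt0 : \forall k \near \oo, 0 < S k + hd (p k).
  by apply: (cvgr_gt _ Spc); exact: addr_gt0.
apply: filterS Sp_gt0 => k Sp0.
have -> : y + t k *: (w + e k *: e1) = p k + (t k * e k) *: e1.
  by rewrite /p scalerDr scalerA addrA.
(* Moving along the axis leaves the tail, hence [S k], unchanged. *)
have -> : tl (p k + (t k * e k) *: e1) = tl (p k).
  by rewrite /tl linearD linearZ /e1 /= col_mxKd scaler0 addr0.
rewrite hdD hdZ hd_e1 -/(S k).
have : hd (p k) ^+ 2 - S k ^+ 2 = t k * (2 * a + t k * dotv w (hat w)).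
  by rewrite -dotv_hatxx dotv_hat_step q0 add0r.
have Sp : S k + hd (p k) != 0 by rewrite gt_eqF.
have yn : hd y != 0 by rewrite gt_eqF.
rewrite /e; set f := (2 * a + _) / _ => E.
have {}E : hd (p k) = S k + t k * f.
  by rewrite /f mulrA -E; field.
by rewrite {1}E; ring.
Qed.

Lemma soc_enorm z a : 0 <= a -> hd z = enorm (tl z) + a -> K z.
Proof. by move=> a0 e; rewrite /soc /= e lerDl. Qed.

(** * Sufficiency: construction of inner tangents *)

Lemma inner_tangent_compl_interior y w :
  Om (0, y) -> interior K y -> inner_tangent Om (0, y) (0, w).
Proof.
move=> yO yi; apply: inner_tangent_compl_near => // t [_ t0].
exists (fun=> 0), (fun=> w); split; [exact: cvg_cst|exact: cvg_cst|].
have pc : y + t k *: w @[k --> \oo] --> y by exact: (cvg_step _ _ _ _ t0 (cvg_cst w)).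
have nearK : \forall k \near \oo, K (y + t k *: w) by exact: pc.
apply: filterS nearK => k yK; rewrite scaler0 addr0.
by split=> //=; [case: yO|rewrite dotv0l].
Qed.

Lemma inner_tangent_compl_boundary_soc y w :
  Om (0, y) -> 0 < hd y -> dotv y (hat y) = 0 -> 0 <= dotv w (hat y) ->
  inner_tangent Om (0, y) (0, w).
Proof.
move=> yO y0 q0 wy; apply: inner_tangent_compl_near => // t tP.
have [v vw vK] := boundary_step y w t y0 q0 tP.
exists (fun=> 0), v; split=> //; first exact: cvg_cst.
apply: filterS vK => k vK; rewrite scaler0 addr0.
split=> /=; [by case: yO| |by rewrite dotv0l].
apply: (soc_enorm _ _ _ vK); apply: mulr_ge0; first exact: (ltW (tP.1 k)).
exact: (divr_ge0 wy (ltW y0)).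
Qed.

Lemma inner_tangent_compl_boundary_ray y d w :
  Om (0, y) -> 0 < hd y -> dotv y (hat y) = 0 -> ray (hat y) d ->
  dotv w (hat y) = 0 -> inner_tangent Om (0, y) (d, w).
Proof.
move=> yO y0 q0 [s /= s0 <-] wy; apply: inner_tangent_compl_near => // t tP.
have [v vw vK] := boundary_step y w t y0 q0 tP.
(* The first component is kept on the ray of the reflected moved point, so that the pair is
   [(t k * s) *: hat z] and [z] with [z] on the boundary. *)
exists (fun k => s *: hat (y + t k *: v k)), v; split=> //.
  apply: cvgZ; first exact: cvg_cst.
  by apply: cvg_hat; exact: (cvg_step _ _ _ _ tP.2 vw).
apply: filterS vK => k; rewrite wy mul0r mulr0 => vK.
have zK := soc_enorm _ _ (lexx 0) vK.
rewrite scalerA add0r; split=> //=.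
  by apply: socZ; [exact: (mulr_ge0 (ltW (tP.1 k)))|exact: soc_hat].
by rewrite dotvZl dotvC dotv_hatxx vK addr0 subrr mulr0.
Qed.

(** Here [y = c *: hat x], and the line condition says [w = r *: hat x + c *: hat d]: this is the
    derivative at 0 of [(c + t r) *: hat (x + t d)]. So [x] is moved along the boundary and the
    second point follows its reflection. *)
Lemma inner_tangent_compl_boundary x y d w :
  Om (x, y) -> 0 < hd x -> dotv x (hat x) = 0 -> 0 < hd y ->
  line x (hd x *: hat w - hd y *: d) -> dotv d y = 0 ->
  inner_tangent Om (x, y) (d, w).
Proof.
move=> xyO x0 q0 y0 [s _ sE] dy.
pose c := hd y / hd x; pose r := s / hd x.
have c0 : 0 < c by rewrite divr_gt0.
have xn : hd x != 0 by rewrite gt_eqF.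
have yE : y = c *: hat x.
  have e := soc_compl_hat _ _ xyO.
  apply: (can_inj hatK); rewrite hatZ hatK /c mulrC -scalerA -e scalerA.
  by rewrite mulVf ?scale1r.
have wE : w = r *: hat x + c *: hat d.
  apply: (can_inj hatK); rewrite hatD !hatZ !hatK /r /c ![_ / _]mulrC.
  by rewrite -!scalerA -scalerDr sE subrK scalerA mulVf ?scale1r.
have dx : dotv d (hat x) = 0.
  by move: dy; rewrite yE dotvZr => /eqP; rewrite mulf_eq0 gt_eqF//= => /eqP.
apply: inner_tangent_compl_near => // t tP.
have [v vd vK] := boundary_step x d t x0 q0 tP.
have crc : c + t k * r @[k --> \oo] --> c + 0 * r.
  by apply: cvgD; [exact: cvg_cst|apply: cvgM; [exact: tP.2|exact: cvg_cst]].
(* This is [(c + t r) *: hat (x + t v) - c *: hat x] divided by [t]. *)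
exists v, (fun k => r *: hat x + (c + t k * r) *: hat (v k)); split=> //.
  have : r *: hat x + (c + t k * r) *: hat (v k) @[k --> \oo] -->
      r *: hat x + (c + 0 * r) *: hat d.
    by apply: cvgD; [exact: cvg_cst|apply: cvgZ => //; exact: cvg_hat].
  by rewrite mul0r addr0 -wE.
have cr_gt0 : \forall k \near \oo, 0 < c + t k * r.
  by apply: (cvgr_gt _ crc); rewrite mul0r addr0.
apply: filterS2 vK cr_gt0 => k; rewrite dx mul0r mulr0 => vK cr0.
have zK := soc_enorm _ _ (lexx 0) vK.
have -> : y + t k *: (r *: hat x + (c + t k * r) *: hat (v k)) =
    (c + t k * r) *: hat (x + t k *: v k).
  rewrite yE hatD hatZ !scalerDr !scalerA addrA -scalerDl.
  by congr (_ + _ *: _); ring.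
split=> //=; first by apply: socZ; [exact: ltW|exact: soc_hat].
by rewrite dotvZr dotv_hatxx vK addr0 subrr mulr0.
Qed.

Lemma inner_tangent_compl0 d w : Om (d, w) -> inner_tangent Om (0, 0) (d, w).
Proof.
move=> [/= dK wK dw] t tP; exists (fun=> (d, w)); split; first exact: cvg_cst.
move=> k; have tk := ltW (tP.1 k); split=> /=; rewrite ?add0r; try exact: socZ.
by rewrite dotvZl dotvZr dw !mulr0.
Qed.

(** * Necessity: conditions satisfied by tangent directions *)

Lemma soc_cvg (v : nat -> 'cV[R]_(1 + n)) d :
  v @ \oo --> d -> (forall k, K (v k)) -> K d.
Proof.
move=> vd vK; have vhd := cvg_hd _ _ vd.
have vq : dotv (v k) (hat (v k)) @[k --> \oo] --> dotv d (hat d).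
  by apply: cvg_dotv => //; exact: cvg_hat.
by apply/socP; split; [apply: (cvg_ge0 _ _ vhd)|apply: (cvg_ge0 _ _ vq)] => k;
   case/socP: (vK k).
Qed.

Lemma soc_scale_inv a z : 0 < a -> K (a *: z) -> K z.
Proof.
move=> a0 azK; rewrite -[z]scale1r -(mulVf (lt0r_neq0 a0)) -scalerA.
by apply: socZ => //; rewrite invr_ge0 ltW.
Qed.

(** As [Q y = 0], the inequality [Q (y + t v) >= 0] is divisible by [t] and leaves
    [2 dotv v (hat y) + t Q v >= 0]. *)
Lemma tangent_soc y w :
  dotv y (hat y) = 0 -> tangent K y w -> 0 <= dotv w (hat y).
Proof.
move=> q0 [t [v [[tgt t0] vw vK]]].
have vc : 2 * dotv (v k) (hat y) + t k * dotv (v k) (hat (v k)) @[k --> \oo]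
    --> 2 * dotv w (hat y) + 0 * dotv w (hat w).
  apply: cvgD; apply: cvgM => //; try exact: cvg_cst.
  - by apply: cvg_dotv => //; exact: cvg_cst.
  - by apply: cvg_dotv => //; exact: cvg_hat.
have : 0 <= 2 * dotv w (hat y) + 0 * dotv w (hat w).
  apply: (cvg_ge0 _ _ vc) => k; have /socP[_] := vK k.
  by rewrite dotv_hat_step q0 add0r pmulr_rge0.
by rewrite mul0r addr0 pmulr_rge0.
Qed.

Lemma tangent_compl_r x y d w : tangent Om (x, y) (d, w) -> tangent K y w.
Proof.
move=> /tangent_complP[t [dk [wk [t0 _ ww C]]]].
by exists t, wk; split=> // k; case: (C k).
Qed.

Lemma tangent_soc0 d : tangent K 0 d -> K d.
Proof.
move=> [t [v [[tgt _] vd vK]]]; apply: (soc_cvg _ _ vd) => k.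
by apply: (soc_scale_inv _ _ (tgt k)); have := vK k; rewrite add0r.
Qed.

Lemma tangent_compl_dotv x y d w : dotv x y = 0 ->
  tangent Om (x, y) (d, w) -> dotv d y + dotv x w = 0.
Proof.
move=> xy /tangent_complP[t [dk [wk [[tgt t0] dd ww C]]]].
have vc : dotv (dk k) y + dotv x (wk k) + t k * dotv (dk k) (wk k) @[k --> \oo]
    --> dotv d y + dotv x w + 0 * dotv d w.
  apply: cvgD; last by apply: cvgM => //; exact: cvg_dotv.
  by apply: cvgD; apply: cvg_dotv => //; exact: cvg_cst.
rewrite mul0r addr0 in vc.
apply: (cvg_cst_eq _ _ _ vc) => k.
have [_ _ /=] := C k; rewrite !(dotvDl, dotvDr, dotvZl, dotvZr) xy add0r => e.
apply: (mulfI (lt0r_neq0 (tgt k))); rewrite mulr0 -[RHS]e; ring.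
Qed.

Lemma tangent_compl0_dotv d w : tangent Om (0, 0) (d, w) -> dotv d w = 0.
Proof.
move=> /tangent_complP[t [dk [wk [[tgt t0] dd ww C]]]].
apply: (cvg_cst_eq _ _ _ (cvg_dotv _ _ _ _ _ dd ww)) => k.
have [_ _ /=] := C k; rewrite !add0r dotvZl dotvZr => /eqP.
by rewrite !mulf_eq0 (gt_eqF (tgt k)) /= => /eqP.
Qed.

(** First-order part of the identity of [soc_compl_hat]: its instance at [(x, y)] is subtracted from
    the one at the moved pair, and the difference is divided by [t]. *)
Lemma tangent_compl_hat x y d w : Om (x, y) -> tangent Om (x, y) (d, w) ->
  hd x *: hat w - hd y *: d = hd w *: x - hd d *: hat y.
Proof.
move=> xyO /tangent_complP[t [dk [wk [[tgt t0] dd ww C]]]].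
have vc : hd x *: hat (wk k) - hd y *: dk k - (hd (wk k) *: x - hd (dk k) *: hat y)
      + t k *: (hd (dk k) *: hat (wk k) - hd (wk k) *: dk k) @[k --> \oo]
    --> hd x *: hat w - hd y *: d - (hd w *: x - hd d *: hat y)
      + 0 *: (hd d *: hat w - hd w *: d).
  have dd1 : hd (dk k) @[k --> \oo] --> hd d by exact: cvg_hd.
  have ww1 : hd (wk k) @[k --> \oo] --> hd w by exact: cvg_hd.
  have wwh : hat (wk k) @[k --> \oo] --> hat w by exact: cvg_hat.
  apply: cvgD; last by apply: cvgZ => //; apply: cvgB; [exact: (cvgZ dd1 wwh)|exact: (cvgZ ww1 dd)].
  by apply: cvgB; apply: cvgB; apply: cvgZ => //; exact: cvg_cst.
rewrite scale0r addr0 in vc; apply/eqP; rewrite -subr_eq0; apply/eqP.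
apply: (cvg_cst_eq _ _ _ vc) => k.
have := soc_compl_hat _ _ (C k); have := soc_compl_hat _ _ xyO.
rewrite !(hdD, hdZ) hatD hatZ; move: (hat y) (hat (wk k)) => Y W e0 e.
apply: (scalerI (lt0r_neq0 (tgt k))); rewrite scaler0.
apply/matrixP => i j.
move: (congr1 (fun M : 'cV[R]_(1 + n) => M i j) e0) (congr1 (fun M : 'cV[R]_(1 + n) => M i j) e).
rewrite !mxE => f0 f.
lra.
Qed.

(** Replacing [hd y *: x] by [hd x *: hat y] leaves [hd x * dotv (hat y) (hat x)], and [hat] is an
    isometry. *)
Lemma soc_compl_hatxx x y : Om (x, y) -> hd y * dotv x (hat x) = 0.
Proof.
move=> xyO; case: (xyO) => /= _ _ xy.
by rewrite -dotvZl -(soc_compl_hat _ _ xyO) dotvZl dotv_hat_hat dotvC xy mulr0.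
Qed.

(** While the second head stays away from 0, [soc_compl_hatxx] keeps the first point on the
    boundary, so [d] is tangent to the surface [Q = 0]. *)
Lemma tangent_compl_boundary x y d w : dotv x (hat x) = 0 -> 0 < hd y ->
  tangent Om (x, y) (d, w) -> dotv d (hat x) = 0.
Proof.
move=> q0 y0 /tangent_complP[t [dk [wk [[tgt t0] dd ww C]]]].
have vc : hd (y + t k *: wk k) * (2 * dotv (dk k) (hat x) + t k * dotv (dk k) (hat (dk k)))
   @[k --> \oo] --> hd y * (2 * dotv d (hat x) + 0 * dotv d (hat d)).
  apply: cvgM; first by apply: cvg_hd; exact: (cvg_step _ _ _ _ t0 ww).
  apply: cvgD; apply: cvgM => //; try exact: cvg_cst.
  - by apply: cvg_dotv => //; exact: cvg_cst.
  - by apply: cvg_dotv => //; exact: cvg_hat.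
have /eqP : hd y * (2 * dotv d (hat x) + 0 * dotv d (hat d)) = 0.
  apply: (cvg_cst_eq _ _ _ vc) => k; have := soc_compl_hatxx _ _ (C k).
  rewrite dotv_hat_step q0 add0r mulrCA => /eqP.
  by rewrite mulf_eq0 (gt_eqF (tgt k)) /= => /eqP.
by rewrite mul0r addr0 !mulf_eq0 pnatr_eq0 (gt_eqF y0) /= => /eqP.
Qed.

(** The first point is [t dk], so both factors of [hd x * Q y = 0] are divisible by [t] along the
    sequence. The limit is a product, the source of the either-or in the case [x = 0], [y] on the
    boundary. *)
Lemma tangent_compl0_boundary y d w : dotv y (hat y) = 0 ->
  tangent Om (0, y) (d, w) -> hd d * dotv w (hat y) = 0.
Proof.
move=> q0 /tangent_complP[t [dk [wk [[tgt t0] dd ww C]]]].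
have vc : hd (dk k) * (2 * dotv (wk k) (hat y) + t k * dotv (wk k) (hat (wk k)))
   @[k --> \oo] --> hd d * (2 * dotv w (hat y) + 0 * dotv w (hat w)).
  apply: cvgM; first exact: cvg_hd.
  apply: cvgD; apply: cvgM => //; try exact: cvg_cst.
  - by apply: cvg_dotv => //; exact: cvg_cst.
  - by apply: cvg_dotv => //; exact: cvg_hat.
have /eqP : hd d * (2 * dotv w (hat y) + 0 * dotv w (hat w)) = 0.
  apply: (cvg_cst_eq _ _ _ vc) => k.
  have := soc_compl_hatxx _ _ (soc_complC _ _ (C k)).
  rewrite add0r dotv_hat_step q0 add0r hdZ => /eqP.
  by rewrite !mulf_eq0 (gt_eqF (tgt k)) /= -mulf_eq0 => /eqP.
by rewrite mul0r addr0 mulrCA mulf_eq0 pnatr_eq0 /= => /eqP.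
Qed.

(** In the limit [d] lies in the cone and is orthogonal to [y], so [(d, y)] is itself a
    complementary pair. *)
Lemma tangent_compl0_interior y d w : Om (0, y) -> interior K y ->
  tangent Om (0, y) (d, w) -> d = 0.
Proof.
move=> yO yi dwT; apply: (soc_compl_interior d y _ yi); split=> /=.
- by apply: tangent_soc0; apply: tangent_compl_r; exact: tangent_complC dwT.
- by case: yO.
- by have := tangent_compl_dotv _ _ _ _ (dotv0l _) dwT; rewrite dotv0l addr0.
Qed.

Lemma tangent_compl0_cases y d w : Om (0, y) -> 0 < hd y -> dotv y (hat y) = 0 ->
  tangent Om (0, y) (d, w) ->
  (d = 0 /\ tangent K y w) \/ (ray (hat y) d /\ dotv w (hat y) = 0).
Proof.
move=> yO y0 q0 dwT; have [d0|dn] := eqVneq d 0.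
  by left; split=> //; exact: tangent_compl_r dwT.
have dK : K d by apply: tangent_soc0; apply: tangent_compl_r; exact: tangent_complC dwT.
right; split.
  apply: soc_compl_ray y0; split=> //=; first by case: yO.
  by have := tangent_compl_dotv _ _ _ _ (dotv0l _) dwT; rewrite dotv0l addr0.
have /eqP := tangent_compl0_boundary _ _ _ q0 dwT; rewrite mulf_eq0.
(* A nonzero [d] in the cone has a nonzero head, so the other factor vanishes. *)
by case/orP => /eqP // /(hd_eq0 _ dK) d0; rewrite d0 eqxx in dn.
Qed.

End TangentFormulas.

(** * Assembly of the six cases *)

Theorem theorem5p1 (R : realType) (n : nat) (x y : 'cV[R]_(1 + n))
    (hxy : @soc_compl R n (x, y)) :
  inner_tangent (@soc_compl R n) (x, y) = tangent (@soc_compl R n) (x, y) /\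
  tangent (@soc_compl R n) (x, y) =
  [set dw : 'cV[R]_(1 + n) * 'cV[R]_(1 + n) | let d := dw.1 in let w := dw.2 in
    [\/ [/\ x = 0, interior (@soc R n) y & d = 0],
        [/\ interior (@soc R n) x, y = 0 & w = 0],
        (bd (@soc R n) `\ 0) x /\ (bd (@soc R n) `\ 0) y /\
          [/\ line x (hd x *: hat w - hd y *: d), dotv d y = 0 & dotv w x = 0] |
     [\/ [/\ x = 0, (bd (@soc R n) `\ 0) y &
            (d = 0 /\ tangent (@soc R n) y w) \/
            (ray (hat y) d /\ dotv w (hat y) = 0)],
        [/\ (bd (@soc R n) `\ 0) x, y = 0 &
            (tangent (@soc R n) x d /\ w = 0) \/
            (dotv d (hat x) = 0 /\ ray (hat x) w)] |
        [/\ x = 0, y = 0 & [/\ soc d, soc w & dotv d w = 0]]]]].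
Proof.
set Om := @soc_compl R n; set S := [set _ | _].
have hyx := soc_complC _ _ hxy; have [/= xK yK xy] := hxy.
(* Inner tangents are tangents, so these two inclusions close a cycle and give both equalities. *)
suff [TS SI] : tangent Om (x, y) `<=` S /\ S `<=` inner_tangent Om (x, y).
  have IT := @inner_tangent_sub R _ Om (x, y).
  by split; apply/seteqP; split=> // u; [move/TS/SI|move/SI/IT].
split=> [[d w] dwT|[d w]].
- have wdT := tangent_complC _ _ _ _ dwT; rewrite /S /=.
  have [x0|xi|xb] := soc_cases x xK; have [y0|yi|yb] := soc_cases y yK.
  + subst x y; constructor 4; constructor 3; split=> //; split.
    * by apply: tangent_soc0; exact: tangent_compl_r wdT.
    * by apply: tangent_soc0; exact: tangent_compl_r dwT.
    * exact: tangent_compl0_dotv dwT.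
  + by subst x; constructor 1; split=> //; exact: tangent_compl0_interior dwT.
  + subst x; constructor 4; constructor 1; split=> //.
    by have [? ?] := (bd_socP y yK).1 yb; exact: tangent_compl0_cases.
  + by subst y; constructor 2; split=> //; exact: tangent_compl0_interior wdT.
  (* Two interior points are never complementary; instead of a contradiction, [y = 0] is derived
     from [x] being interior, which lands in the second case. *)
  + constructor 2; split=> //; first exact: soc_compl_interior hyx xi.
    by have y0 := soc_compl_interior _ _ hyx xi; subst y; exact: tangent_compl0_interior wdT.
  + by have y0 := soc_compl_interior _ _ hyx xi; case: yb.
  + subst y; constructor 4; constructor 2; split=> //.
    have [hx qx] := (bd_socP x xK).1 xb.
    by have [[? ?]|[? ?]] := tangent_compl0_cases _ _ _ hyx hx qx wdT; [left|right].
  + by have x0 := soc_compl_interior _ _ hxy yi; case: xb.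
  + constructor 3; split=> //; split=> //.
    have [hx qx] := (bd_socP x xK).1 xb; have [hy qy] := (bd_socP y yK).1 yb.
    have dx := tangent_compl_boundary _ _ _ _ qx hy dwT.
    have [c _ yE] := soc_compl_ray _ _ hyx hx.
    have dy : dotv d y = 0 by rewrite -yE dotvZr dx mulr0.
    split=> //; last first.
      by have := tangent_compl_dotv _ _ _ _ xy dwT; rewrite dy add0r dotvC.
    (* Since [y = c *: hat x], [hat y] is [c *: x], and the right-hand side of [tangent_compl_hat]
       becomes a multiple of [x]. *)
    exists (hd w - hd d * c) => //; rewrite (tangent_compl_hat _ _ _ _ hxy dwT).
    by rewrite -yE hatZ hatK scalerA -scalerBl.
- rewrite /S /= => -[[x0 yi d0]|[xi y0 w0]|[xb [yb [dwl dy _]]]|[[x0 yb]|[xb y0]|[x0 y0 [dK wK dw]]]].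
  + by subst x d; exact: inner_tangent_compl_interior.
  + by subst y w; apply: inner_tangent_complC; exact: inner_tangent_compl_interior.
  + have [hx qx] := (bd_socP x xK).1 xb; have [hy qy] := (bd_socP y yK).1 yb.
    exact: inner_tangent_compl_boundary.
  + subst x; have [hy qy] := (bd_socP y yK).1 yb; case=> [[-> wT]|[dr wy]].
      by apply: inner_tangent_compl_boundary_soc => //; exact: tangent_soc.
    exact: inner_tangent_compl_boundary_ray.
  + subst y; have [hx qx] := (bd_socP x xK).1 xb.
    case=> [[dT ->]|[dx wr]]; apply: inner_tangent_complC.
      by apply: inner_tangent_compl_boundary_soc => //; exact: tangent_soc.
    exact: inner_tangent_compl_boundary_ray.
  + by subst x y; exact: inner_tangent_compl0.
Qed.
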